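(* Consider a delta with parameters $({S'}^{\text{se}},\nu')$ from $x$ to $y$, $({Q'}^{\text{se}},\mu')$ from $y$ to $z$ and $({R'}^{\text{se}},\lambda')$ from $z$ to $x$ (all parameters positive). It can be transformed into an equivalent star, with parameters $(Q^{\text{se}},\mu)$ from $x$ to the centre, $(R^{\text{se}},\lambda)$ from $y$ to the centre and $(S^{\text{se}},\nu)$ from $z$ to the centre, if and only if $$\lambda'\cdot\nu'\cdot\mu'=1.$$ Even in this case the resulting star is not unique: with any positive number $\alpha>0$, it can have parameters $$S^{\text{se}}=\frac{{\lambda'}^{1/3}{\nu'}^{2/3}\alpha{R'}^{\text{se}}{Q'}^{\text{se}}}{{\lambda'}^{2/3}{\nu'}^{1/3}{Q'}^{\text{se}}+{\nu'}^{2/3}{\mu'}^{1/3}{R'}^{\text{se}}+{\lambda'}^{1/3}{\mu'}^{2/3}{S'}^{\text{se}}},$$ $$Q^{\text{se}}=\frac{{\nu'}^{1/3}{\mu'}^{2/3}\alpha{R'}^{\text{se}}{S'}^{\text{se}}}{{\lambda'}^{2/3}{\nu'}^{1/3}{Q'}^{\text{se}}+{\nu'}^{2/3}{\mu'}^{1/3}{R'}^{\text{se}}+{\lambda'}^{1/3}{\mu'}^{2/3}{S'}^{\text{se}}},$$ $$R^{\text{se}}=\frac{{\lambda'}^{2/3}{\mu'}^{1/3}\alpha{Q'}^{\text{se}}{S'}^{\text{se}}}{{\lambda'}^{2/3}{\nu'}^{1/3}{Q'}^{\text{se}}+{\nu'}^{2/3}{\mu'}^{1/3}{R'}^{\text{se}}+{\lambda'}^{1/3}{\mu'}^{2/3}{S'}^{\text{se}}},$$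 and $\lambda={\lambda'}^{1/3}{\mu'}^{2/3}\alpha$, $\nu={\lambda'}^{2/3}{\nu'}^{1/3}\alpha$, $\mu={\nu'}^{2/3}{\mu'}^{1/3}\alpha$.
   Context: Units are described here by their ''secunder'' form: a unit with parameters $(R^{\text{se}},\lambda)$ from $p$ to $q$ ($R^{\text{se}},\lambda>0$) consists of a voltage amplifier multiplying the potential by $\lambda$ in the direction from $p$ to $q$, followed by a resistor $R^{\text{se}}$ on the $q$ side. With potentials $u_p,u_q$ at its ends the current through it from $p$ to $q$ is $i_{pq}=-i_{qp}=\frac{\lambda u_p-u_q}{R^{\text{se}}}$. (It is equivalent to the original symmetric-resistor unit of parameters $(R,\lambda)$ with $R^{\text{se}}=R(\lambda+1)/2$.) A star consists of three units joining terminals $x,y,z$ to a central vertex that has no further connections, so the sum of the currents flowing into the centre is zero. A delta consists of three units joining $x$ to $y$, $y$ to $z$ and $z$ to $x$. Two such networks with terminals $x,y,z$ are equivalent if for all terminal potentials $U_x,U_y,U_z\in\mathbb R$ the currents $i_x,i_y,i_z$ flowing from the terminals into the network agree for the two networks. *)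

(* Defs.v *)
From Stdlib Require Import Reals.
Open Scope R_scope.

(* A unit in secunder form, oriented from [p] to [q]: an amplifier of factor
   [amp] on the [p] side followed by a resistor [rse] on the [q] side. *)
Record eunit : Type := Unit { rse : R; amp : R }.

Definition eunit_pos (e : eunit) : Prop := 0 < rse e /\ 0 < amp e.

(* The current flowing from [p] to [q]; the current from [q] to [p] is its
   opposite. *)
Definition current (e : eunit) (up uq : R) : R := (amp e * up - uq) / rse e.

(* A network with terminals x, y, z is described by the relation it imposes
   between the terminal potentials (Ux, Uy, Uz) and the currents (ix, iy, iz)
   flowing from the terminals into the network. *)
Definition behaviour : Type := R -> R -> R -> R -> R -> R -> Prop.

(* Each unit is oriented from the terminal to the centre. *)
Record star_net : Type := StarNet { unit_xc : eunit; unit_yc : eunit; unit_zc : eunit }.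

Definition star_pos (s : star_net) : Prop :=
  eunit_pos (unit_xc s) /\ eunit_pos (unit_yc s) /\ eunit_pos (unit_zc s).

(* The potential [uc] of the centre is not imposed from outside: it adjusts
   itself so that the currents flowing into the centre add up to zero. *)
Definition star_behaviour (s : star_net) : behaviour :=
  fun Ux Uy Uz ix iy iz =>
    exists uc : R,
      ix = current (unit_xc s) Ux uc /\
      iy = current (unit_yc s) Uy uc /\
      iz = current (unit_zc s) Uz uc /\
      ix + iy + iz = 0.

Record delta_net : Type := DeltaNet { unit_xy : eunit; unit_yz : eunit; unit_zx : eunit }.

Definition delta_behaviour (d : delta_net) : behaviour :=
  fun Ux Uy Uz ix iy iz =>
    ix = current (unit_xy d) Ux Uy - current (unit_zx d) Uz Ux /\
    iy = current (unit_yz d) Uy Uz - current (unit_xy d) Ux Uy /\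
    iz = current (unit_zx d) Uz Ux - current (unit_yz d) Uy Uz.

Definition equivalent (N N' : behaviour) : Prop :=
  forall Ux Uy Uz ix iy iz : R,
    N Ux Uy Uz ix iy iz <-> N' Ux Uy Uz ix iy iz.

Definition star_of_delta (d : delta_net) (s : star_net) : Prop :=
  star_pos s /\ equivalent (delta_behaviour d) (star_behaviour s).

(* Main.v *)
Require Import Defs.
From Stdlib Require Import Reals Lra.
Open Scope R_scope.

(** Eliminating the potential of the centre turns every star into a delta
    ([delta_of_star]). With [P = Q R + R S + S Q], the star sends the current
    [S (mu Ux - lambda Uy) / P] from [x] to [y], and cyclically; this is the
    current of a single unit of amplification [mu / lambda]. Conversely, a
    delta with nonzero resistances can be read off from its currents, because
    probing with a unit potential at one terminal at a time exhibits each
    coefficient ([delta_behaviour_inj]). So a star with positive parameters is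
    equivalent to a delta [d] exactly when its own delta is [d]
    ([star_of_deltaE]), and the whole question becomes which deltas are values
    of [delta_of_star].

    The amplifications [mu / lambda], [lambda / nu] and [nu / mu] of such a
    delta multiply to [1], whence the necessity of the condition. Conversely,
    write the amplifications of [d] as cubes of [a], [b], [c] with [a b c = 1];
    then the given formulas solve [delta_of_star s = d] by direct computation.
    The factor [alpha] is free because multiplying every amplification and
    every resistance of a star by the same number only rescales the potential
    of its centre. *)

Ltac positivity :=
  repeat first
    [ assumption | exact Rlt_0_1 | apply exp_pos | apply Rplus_lt_0_compat
    | apply Rdiv_lt_0_compat | apply Rmult_lt_0_compat | apply pow_lt
    | apply Rinv_0_lt_compat ].

(** The total conductance of the star times the product of its three
    resistances; it is the common denominator of all its currents. *)
Definition pair_sum (s : star_net) : R :=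
  rse (unit_xc s) * rse (unit_yc s) + rse (unit_yc s) * rse (unit_zc s)
  + rse (unit_zc s) * rse (unit_xc s).

Definition delta_of_star (s : star_net) : delta_net :=
  let (x, y, z) := s in
  DeltaNet
    (Unit (pair_sum s / (amp y * rse z)) (amp x / amp y))
    (Unit (pair_sum s / (amp z * rse x)) (amp y / amp z))
    (Unit (pair_sum s / (amp x * rse y)) (amp z / amp x)).

Lemma pair_sum_pos (s : star_net) : star_pos s -> 0 < pair_sum s.
Proof.
  intros [[Hx _] [[Hy _] [Hz _]]]. unfold pair_sum. positivity.
Qed.

(** The balance of the currents at the centre determines its potential as the
    mean of the amplified terminal potentials weighted by the conductances. *)
Lemma star_equivalent_delta_of_star (s : star_net) :
  star_pos s -> equivalent (star_behaviour s) (delta_behaviour (delta_of_star s)).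
Proof.
  intros Hs Ux Uy Uz ix iy iz.
  assert (HP := pair_sum_pos s Hs).
  destruct s as [[Q mu] [R0 la] [S0 nu]].
  destruct Hs as [[HQ Hmu] [[HR Hla] [HS Hnu]]].
  unfold star_behaviour, delta_behaviour, delta_of_star, pair_sum,
    current in *; simpl in *.
  set (P := Q * R0 + R0 * S0 + S0 * Q) in *.
  set (U := (mu * R0 * S0 * Ux + la * S0 * Q * Uy + nu * Q * R0 * Uz) / P).
  split.
  - intros (uc & -> & -> & -> & Hsum).
    assert (Huc : uc = U).
    { assert (HPuc : mu * R0 * S0 * Ux + la * S0 * Q * Uy + nu * Q * R0 * Uz
                     - P * uc = 0).
      { transitivity (Q * R0 * S0 *
          ((mu * Ux - uc) / Q + (la * Uy - uc) / R0 + (nu * Uz - uc) / S0)).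
        - unfold P. field. lra.
        - rewrite Hsum. ring. }
      unfold U. apply Rmult_eq_reg_l with P; [|lra].
      transitivity (mu * R0 * S0 * Ux + la * S0 * Q * Uy + nu * Q * R0 * Uz).
      - lra.
      - field. lra. }
    rewrite Huc. unfold U, P in *. repeat split; field; lra.
  - intros (-> & -> & ->). exists U.
    unfold U, P in *. repeat split; field; lra.
Qed.

(** Raising one terminal to potential [1] while the others are grounded shows
    the two units at that terminal separately, as the currents leaving the
    two grounded terminals. *)
Lemma delta_behaviour_inj (d d' : delta_net) :
  rse (unit_xy d) <> 0 -> rse (unit_yz d) <> 0 -> rse (unit_zx d) <> 0 ->
  rse (unit_xy d') <> 0 -> rse (unit_yz d') <> 0 -> rse (unit_zx d') <> 0 ->
  equivalent (delta_behaviour d) (delta_behaviour d') -> d = d'.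
Proof.
  destruct d as [[a k] [b l] [c m]], d' as [[a' k'] [b' l'] [c' m']]; simpl.
  intros Ha Hb Hc Ha' Hb' Hc' E.
  (* Both deltas are given by functions, so the equivalence is an equality of
     the currents of the first with those of the second. *)
  assert (F : forall Ux Uy Uz, delta_behaviour
      (DeltaNet (Unit a' k') (Unit b' l') (Unit c' m')) Ux Uy Uz
      ((k * Ux - Uy) / a - (m * Uz - Ux) / c)
      ((l * Uy - Uz) / b - (k * Ux - Uy) / a)
      ((m * Uz - Ux) / c - (l * Uy - Uz) / b)).
  { intros Ux Uy Uz. apply E. repeat split. }
  destruct (F 1 0 0) as (_ & Xy & Xz).
  destruct (F 0 1 0) as (Yx & _ & Yz).
  destruct (F 0 0 1) as (Zx & Zy & _).
  clear E F. unfold current, Rdiv in *; simpl in *.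
  assert (Ia : / a = / a') by lra.
  assert (Ib : / b = / b') by lra.
  assert (Ic : / c = / c') by lra.
  apply Rinv_eq_reg in Ia, Ib, Ic. subst a' b' c'.
  assert (cancel : forall r u v, r <> 0 -> u * / r = v * / r -> u = v).
  { intros r u v Hr H. apply Rmult_eq_reg_r with (/ r); trivial.
    now apply Rinv_neq_0_compat. }
  assert (k = k') by (apply (cancel a); lra).
  assert (l = l') by (apply (cancel b); lra).
  assert (m = m') by (apply (cancel c); lra).
  now subst.
Qed.

Lemma star_of_deltaE (d : delta_net) (s : star_net) :
  rse (unit_xy d) <> 0 -> rse (unit_yz d) <> 0 -> rse (unit_zx d) <> 0 ->
  star_of_delta d s <-> star_pos s /\ d = delta_of_star s.
Proof.
  intros Hxy Hyz Hzx. unfold star_of_delta.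
  split; intros [Hs E]; split; trivial;
    assert (ES := star_equivalent_delta_of_star s Hs).
  - assert (HP := pair_sum_pos s Hs).
    assert (quotient : forall u v, 0 < u -> 0 < v -> pair_sum s / (u * v) <> 0).
    { intros u v Hu Hv. apply Rgt_not_eq. positivity. }
    assert (Hs' := Hs).
    destruct s as [x y z], Hs' as [[? ?] [[? ?] [? ?]]].
    apply delta_behaviour_inj; trivial; try now apply quotient.
    intros Ux Uy Uz ix iy iz.
    now rewrite (E Ux Uy Uz ix iy iz).
  - subst d. intros Ux Uy Uz ix iy iz. now rewrite (ES Ux Uy Uz ix iy iz).
Qed.

(** Taking the cube roots [a], [b], [c] of [lambda'], [nu'], [mu'] as
    parameters makes every formula for the star rational. *)
Lemma star_of_delta_cubes (a b c Sse Qse Rse alpha : R) :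
  0 < a -> 0 < b -> 0 < c -> a * b * c = 1 ->
  0 < Sse -> 0 < Qse -> 0 < Rse -> 0 < alpha ->
  let D := a ^ 2 * b * Qse + b ^ 2 * c * Rse + a * c ^ 2 * Sse in
  star_of_delta
    (DeltaNet (Unit Sse (b ^ 3)) (Unit Qse (c ^ 3)) (Unit Rse (a ^ 3)))
    (StarNet (Unit (b * c ^ 2 * alpha * Rse * Sse / D) (b ^ 2 * c * alpha))
             (Unit (a ^ 2 * c * alpha * Qse * Sse / D) (a * c ^ 2 * alpha))
             (Unit (a * b ^ 2 * alpha * Rse * Qse / D) (a ^ 2 * b * alpha))).
Proof.
  intros Ha Hb Hc Habc HS HQ HR Halpha D.
  assert (HD : 0 < D) by (unfold D; positivity).
  apply star_of_deltaE; simpl; try lra.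
  split.
  - repeat split; simpl; positivity.
  - (* Solving the constraint for [c] turns the six equations between
       parameters into identities of rational functions in [a] and [b]. *)
    assert (Ec : c = / (a * b)).
    { apply Rmult_eq_reg_l with (a * b); [rewrite Habc; field; lra|].
      apply Rgt_not_eq. positivity. }
    unfold delta_of_star, pair_sum; simpl.
    unfold D in *. clear D HD Habc. subst c.
    do 2 f_equal; field; repeat split; apply Rgt_not_eq; positivity.
Qed.

Lemma Rpower_third_cube (x : R) : 0 < x -> Rpower x (1/3) ^ 3 = x.
Proof.
  intros Hx. simpl. rewrite Rmult_1_r, <- !Rpower_plus.
  replace (1/3 + (1/3 + 1/3)) with 1 by field.
  now apply Rpower_1.
Qed.

Lemma Rpower_two_thirds (x : R) : Rpower x (2/3) = Rpower x (1/3) ^ 2.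
Proof.
  simpl. rewrite Rmult_1_r, <- Rpower_plus. f_equal. field.
Qed.

Theorem proposition4p4
  (Sse' nu' Qse' mu' Rse' lambda' : R)
  (hS' : 0 < Sse') (hnu' : 0 < nu') (hQ' : 0 < Qse')
  (hmu' : 0 < mu') (hR' : 0 < Rse') (hlambda' : 0 < lambda') :
  let d := DeltaNet (Unit Sse' nu') (Unit Qse' mu') (Unit Rse' lambda') in
  ((exists s : star_net, star_of_delta d s) <-> lambda' * nu' * mu' = 1) /\
  (lambda' * nu' * mu' = 1 ->
    ~ uniqueness (star_of_delta d) /\
    forall alpha : R, 0 < alpha ->
      let D := Rpower lambda' (2/3) * Rpower nu' (1/3) * Qse'
             + Rpower nu' (2/3) * Rpower mu' (1/3) * Rse'
             + Rpower lambda' (1/3) * Rpower mu' (2/3) * Sse' in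
      let Sse := Rpower lambda' (1/3) * Rpower nu' (2/3) * alpha * Rse' * Qse' / D in
      let Qse := Rpower nu' (1/3) * Rpower mu' (2/3) * alpha * Rse' * Sse' / D in
      let Rse := Rpower lambda' (2/3) * Rpower mu' (1/3) * alpha * Qse' * Sse' / D in
      let lambda := Rpower lambda' (1/3) * Rpower mu' (2/3) * alpha in
      let nu := Rpower lambda' (2/3) * Rpower nu' (1/3) * alpha in
      let mu := Rpower nu' (2/3) * Rpower mu' (1/3) * alpha in
      star_of_delta d (StarNet (Unit Qse mu) (Unit Rse lambda) (Unit Sse nu))).
Proof.
  intros d.
  assert (formula : lambda' * nu' * mu' = 1 -> forall alpha : R, 0 < alpha ->
      let a := Rpower lambda' (1/3) in
      let b := Rpower nu' (1/3) in
      let c := Rpower mu' (1/3) in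
      let D := a ^ 2 * b * Qse' + b ^ 2 * c * Rse' + a * c ^ 2 * Sse' in
      star_of_delta d
        (StarNet (Unit (b * c ^ 2 * alpha * Rse' * Sse' / D) (b ^ 2 * c * alpha))
                 (Unit (a ^ 2 * c * alpha * Qse' * Sse' / D) (a * c ^ 2 * alpha))
                 (Unit (a * b ^ 2 * alpha * Rse' * Qse' / D) (a ^ 2 * b * alpha)))).
  { intros H1 alpha Halpha a b c.
    unfold d. rewrite <- (Rpower_third_cube nu' hnu').
    rewrite <- (Rpower_third_cube mu' hmu').
    rewrite <- (Rpower_third_cube lambda' hlambda').
    apply star_of_delta_cubes; trivial; try apply exp_pos.
    unfold a, b, c. rewrite !Rpower_mult_distr, H1; trivial.
    - unfold Rpower. rewrite ln_1, Rmult_0_r. apply exp_0.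
    - positivity. }
  split; [split|].
  - intros [s Hs].
    apply star_of_deltaE in Hs; simpl; try lra.
    destruct Hs as [Hs E].
    destruct s as [[Q mu] [R0 la] [S0 nu]], Hs as [[_ ?] [[_ ?] [_ ?]]].
    injection E as _ -> _ -> _ ->. simpl in *. field. lra.
  - intros H1. eexists. exact (formula H1 1 Rlt_0_1).
  - intros H1. split.
    + intros uniq.
      assert (E := uniq _ _ (formula H1 1 Rlt_0_1) (formula H1 2 Rlt_0_2)).
      apply (f_equal (fun s => amp (unit_yc s))) in E. simpl amp in E.
      assert (0 < Rpower lambda' (1/3) * Rpower mu' (1/3) ^ 2)
        by (unfold Rpower; positivity).
      lra.
    + intros alpha Halpha. rewrite !Rpower_two_thirds. exact (formula H1 alpha Halpha).
Qed.
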